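(* The function $$g(x,y,z)=\sin(x+y)-\cos(y-z)-\sin(x+z)$$ satisfies $-\Delta g=2g$ on $\mathbb{T}^3$, and it is negative on at least $52\%$ of the volume, that is, $$\operatorname{vol}(\{p\in\mathbb{T}^3:g(p)<0\})\ge 0.52\,\operatorname{vol}(\mathbb{T}^3).$$
   Context: Here $\mathbb{T}^3=\mathbb{R}^3/(2\pi\mathbb{Z})^3$ is the flat torus, with coordinates $(x,y,z)$, $\operatorname{vol}$ is Lebesgue measure on it, and $\Delta=\partial_x^2+\partial_y^2+\partial_z^2$. *)

(* Defs.v *)
From HB Require Import structures.
From mathcomp Require Import all_boot all_order all_algebra archimedean.
From mathcomp Require Import all_classical all_reals all_analysis.
From mathcomp Require Import ring.

Set Implicit Arguments.
Unset Strict Implicit.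
Unset Printing Implicit Defensive.

Import Order.TTheory GRing.Theory Num.Theory.
Import numFieldNormedType.Exports.

Local Open Scope classical_set_scope.
Local Open Scope ring_scope.
Local Open Scope quotient_scope.

Definition lattice (R : realType) : {pred R * R * R} :=
  [pred v | [&& v.1.1 / (2 * pi) \is a Num.int, v.1.2 / (2 * pi) \is a Num.int
              & v.2 / (2 * pi) \is a Num.int]].

Lemma lattice_zmod_closed (R : realType) : zmod_closed (@lattice R).
Proof.
split=> [|[[x y] z] [[x' y'] z']]; rewrite !inE /= ?mul0r ?rpred0 //.
by move=> /and3P[? ? ?] /and3P[? ? ?]; rewrite !mulrBl !rpredB.
Qed.

HB.instance Definition _ (R : realType) :=
  GRing.isZmodClosed.Build (R * R * R)%type (@lattice R)
    (@lattice_zmod_closed R).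

Definition torus (R : realType) := Quotient.quot (@lattice R).

HB.instance Definition _ (R : realType) := GRing.Zmodule.on (torus R).
HB.instance Definition _ (R : realType) := isPointed.Build (torus R) 0.

Definition torus_proj (R : realType) (v : R * R * R) : torus R := \pi v.

Lemma torus_proj_eq (R : realType) (u v : R * R * R) :
  (torus_proj u == torus_proj v) = (u - v \in @lattice R).
Proof. by rewrite Quotient.idealrBE. Qed.

Section volume.
Variable R : realType.

(* [measurableTypeR R] is [R] with the Borel sigma-algebra on which
   [lebesgue_measure] is defined. *)
Definition borel3 : Type :=
  (measurableTypeR R * measurableTypeR R * measurableTypeR R)%type.
HB.instance Definition _ := Measurable.on borel3.

(* The sigma-algebra of the sets whose preimage in R^3 is Borel. *)
Let torus_measurable : set (set (torus R)) :=
  image_set_system setT (@torus_proj R : borel3 -> torus R) measurable.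

Let torus_sigma_algebra : sigma_algebra setT torus_measurable.
Proof. exact/sigma_algebra_image/sigma_algebra_measurable. Qed.

Let torus_measurable0 : torus_measurable set0.
Proof. by case: torus_sigma_algebra. Qed.

Let torus_measurableC A : torus_measurable A -> torus_measurable (~` A).
Proof. by case: torus_sigma_algebra => _ h _ /h; rewrite setTD. Qed.

Let torus_measurable_bigcup (F : (set (torus R))^nat) :
  (forall i, torus_measurable (F i)) -> torus_measurable (\bigcup_i F i).
Proof. by case: torus_sigma_algebra => _ _; apply. Qed.

Definition torus_display : measure_display.
Proof. by constructor. Qed.

HB.instance Definition _ := @isMeasurable.Build torus_display (torus R)
  torus_measurable torus_measurable0 torus_measurableC torus_measurable_bigcup.

Lemma measurable_torus_proj :
  measurable_fun [set: borel3] (@torus_proj R : borel3 -> torus R).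
Proof. by move=> _ A. Qed.

Definition lebesgue_measure3 : set borel3 -> \bar R :=
  ((@lebesgue_measure R \x @lebesgue_measure R) \x @lebesgue_measure R)%E.

HB.instance Definition _ := Measure.on lebesgue_measure3.

Definition cube : set borel3 :=
  `[0, 2 * pi[ `*` `[0, 2 * pi[ `*` `[0, 2 * pi[.

Lemma measurable_cube : measurable cube.
Proof. by apply: measurableX => //; apply: measurableX. Qed.

(* [cube] is a fundamental domain of the lattice, so this is the measure on the
   quotient induced by Lebesgue measure on R^3. *)
Definition vol : set (torus R) -> \bar R :=
  pushforward (mrestr lebesgue_measure3 measurable_cube)
    (@torus_proj R : borel3 -> torus R).

Let vol0 : vol set0 = 0%E.
Proof. by rewrite /vol /pushforward preimage_set0 measure0. Qed.

Let vol_ge0 A : (0 <= vol A)%E.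
Proof. exact: measure_ge0. Qed.

Let vol_sigma_additive : semi_sigma_additive vol.
Proof.
move=> F mF tF mUF; rewrite /vol /pushforward preimage_bigcup.
have mpre A : measurable A ->
    measurable ((@torus_proj R : borel3 -> torus R) @^-1` A).
  move=> mA; rewrite -[X in measurable X]setTI.
  exact: measurable_torus_proj.
apply: measure_semi_sigma_additive.
- by move=> n; exact: mpre.
- apply/trivIsetP => i j _ _ ij; rewrite -preimage_setI.
  by move/trivIsetP : tF => /(_ _ _ _ _ ij) ->//; rewrite preimage_set0.
- by rewrite -preimage_bigcup; exact: mpre.
Qed.

HB.instance Definition _ := isMeasure.Build torus_display (torus R) R vol
  vol0 vol_ge0 vol_sigma_additive.

End volume.

Section laplacian.
Variable R : realType.
Implicit Types (f : torus R -> R) (p : torus R).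

(* Derivatives along the translations of the group R^3 / (2 pi Z)^3; for the
   periodic function on R^3 that lifts f these are d/dx, d/dy and d/dz. *)
Definition partial_x f p : R :=
  derive1 (fun t => f (p + torus_proj (t, 0, 0))) 0.
Definition partial_y f p : R :=
  derive1 (fun t => f (p + torus_proj (0, t, 0))) 0.
Definition partial_z f p : R :=
  derive1 (fun t => f (p + torus_proj (0, 0, t))) 0.

Definition laplacian f p : R :=
  partial_x (partial_x f) p + partial_y (partial_y f) p
  + partial_z (partial_z f) p.

End laplacian.

Section g.
Variable R : realType.

Definition g_lift (v : R * R * R) : R :=
  let: (x, y, z) := v in sin (x + y) - cos (y - z) - sin (x + z).

(* Independent of the representative: see [g_lift_lattice] and [gE]. *)
Definition g (p : torus R) : R := g_lift (repr p).

Let sin_period (x : R) (n : int) : sin (x + n%:~R * (2 * pi)) = sin x.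
Proof.
case: n => n.
  by rewrite -pmulrn mulr_natl mulr_natl (periodicn (@sinD2pi R)).
rewrite -(periodicn (@sinD2pi R) n.+1 (x + _)).
by rewrite NegzE mulrNz mulNr -pmulrn !mulr_natl subrK.
Qed.

Let cos_period (x : R) (n : int) : cos (x + n%:~R * (2 * pi)) = cos x.
Proof.
case: n => n.
  by rewrite -pmulrn mulr_natl mulr_natl (periodicn (@cosD2pi R)).
rewrite -(periodicn (@cosD2pi R) n.+1 (x + _)).
by rewrite NegzE mulrNz mulNr -pmulrn !mulr_natl subrK.
Qed.

Lemma g_lift_lattice (u v : R * R * R) :
  u - v \in @lattice R -> g_lift u = g_lift v.
Proof.
case: u v => [[x y] z] [[x' y'] z']; rewrite inE /=.
have pi0 : 2 * pi != 0 :> R by rewrite mulf_neq0 // gt_eqF // pi_gt0.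
have intE (a b : R) : (a - b) / (2 * pi) \is a Num.int ->
    exists n : int, a = b + n%:~R * (2 * pi).
  move=> /intrP[n nE]; exists n.
  by rewrite -nE divfK // addrC subrK.
move=> /and3P[/intE[i ->] /intE[j ->] /intE[k ->]] /=.
rewrite -(sin_period (x' + y') (i + j)) -(cos_period (y' - z') (j - k)).
rewrite -(sin_period (x' + z') (i + k)) !rmorphD !rmorphN /=.
by congr (sin _ - cos _ - sin _); ring.
Qed.

Lemma gE (x y z : R) :
  g (torus_proj (x, y, z)) = sin (x + y) - cos (y - z) - sin (x + z).
Proof.
rewrite /g -[RHS]/(g_lift (x, y, z)); apply: g_lift_lattice.
by rewrite -torus_proj_eq /torus_proj reprK.
Qed.

End g.

(* Main.v *)
Require Import Defs.
From mathcomp Require Import all_boot all_order all_algebra.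
From mathcomp Require Import all_classical all_reals all_analysis.
From mathcomp Require Import measurable_realfun ring lra.

Import Order.TTheory GRing.Theory Num.Theory.
Import numFieldNormedType.Exports.

Local Open Scope classical_set_scope.
Local Open Scope ring_scope.

(** The eigenvalue equation is a computation with sines and cosines: along a
    coordinate line g is of the form [a sin t + b cos t + c].

    For the volume, fix x and y and let z vary.  Writing [S >= 0] for the
    absolute value of [sin ((x + y + pi / 2) / 2)], so that
    [cos (x + y + pi / 2) = 1 - 2 S^2], the sum-to-product formulas give
    [g (x, y, z) = 2 S^2 - 1 - 2 S cos (z + phi)] for some phi depending on
    x and y ([g_lift_amplitude]).  Hence g is negative as soon as
    [cos (z + phi) > cos al], for
    - [al = pi / 3] in all cases,
    - [al = pi / 2] if [cos (x + y + pi / 2) > cos (pi / 2)],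
    - [al = 2 pi / 3] if [cos (x + y + pi / 2) > cos (pi / 3)],
    - [al = pi] if [cos (x + y + pi / 2) > cos (pi / 6)].

    An arc [cos (u + phi) > cos al] takes up the fraction [al / pi] of a period
    ([arc_length_ge]).  This bounds the length of the fibres over (x, y)
    ([negative_fibre_ge]), and it also bounds the sets of pairs (x, y) above
    ([band_area_ge]): they take up at least the fractions 1 / 2, 1 / 3 and 1 / 6 of the
    square.  By Tonelli, g is negative on at least the fraction
    [1/3 + (1/6) (1/2) + (1/6) (1/3) + (1/3) (1/6) = 19/36 > 0.52]
    of the volume ([negative_volume_ge]). *)

(** * The eigenvalue equation *)

Lemma torus_projD (R : realType) (u v : R * R * R) :
  torus_proj u + torus_proj v = torus_proj (u + v).
Proof. by rewrite /torus_proj raddfD. Qed.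

Lemma torus_projP (R : realType) (p : torus R) :
  exists x y z, p = torus_proj (x, y, z).
Proof.
exists (repr p).1.1, (repr p).1.2, (repr p).2.
by rewrite /torus_proj -!surjective_pairing reprK.
Qed.

Lemma derive1_trig0 (R : realType) (a b c : R) (f : R -> R) :
  (forall t, f t = a * sin t + b * cos t + c) -> derive1 f 0 = a.
Proof.
move=> fE; have {fE}-> : f = a *: @sin R + b *: @cos R + cst c.
  by apply/funext => t; rewrite fE.
have ds : derivable (a *: @sin R) 0 1.
  by apply: derivableZ; exact: derivable_sin.
have dc : derivable (b *: @cos R) 0 1.
  by apply: derivableZ; exact: derivable_cos.
rewrite derive1E deriveD; [|exact: derivableD|exact: derivable_cst].
rewrite deriveD // !deriveZ; [|exact: derivable_cos|exact: derivable_sin].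
rewrite (@derive_val _ _ _ _ _ _ _ (@is_derive_sin R 0)).
rewrite (@derive_val _ _ _ _ _ _ _ (@is_derive_cos R 0)) derive_cst.
by rewrite cos0 sin0 oppr0 scaler0 !addr0 /GRing.scale /= mulr1.
Qed.

(** By the addition formulas for sine and cosine, [g] and its first partial
    derivatives have this form along the lines parallel to an axis. *)
Lemma partial_xE (R : realType) (a b c : R) (f : torus R -> R) x y z :
  (forall t, f (torus_proj (x + t, y, z)) = a * sin t + b * cos t + c) ->
  partial_x f (torus_proj (x, y, z)) = a.
Proof.
move=> fE; apply: (derive1_trig0 _ _ b c) => t.
by rewrite torus_projD -fE; congr (f (torus_proj (_, _, _))); rewrite /= addr0.
Qed.

Lemma partial_yE (R : realType) (a b c : R) (f : torus R -> R) x y z :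
  (forall t, f (torus_proj (x, y + t, z)) = a * sin t + b * cos t + c) ->
  partial_y f (torus_proj (x, y, z)) = a.
Proof.
move=> fE; apply: (derive1_trig0 _ _ b c) => t.
by rewrite torus_projD -fE; congr (f (torus_proj (_, _, _))); rewrite /= addr0.
Qed.

Lemma partial_zE (R : realType) (a b c : R) (f : torus R -> R) x y z :
  (forall t, f (torus_proj (x, y, z + t)) = a * sin t + b * cos t + c) ->
  partial_z f (torus_proj (x, y, z)) = a.
Proof.
move=> fE; apply: (derive1_trig0 _ _ b c) => t.
by rewrite torus_projD -fE; congr (f (torus_proj (_, _, _))); rewrite /= addr0.
Qed.

Lemma partial_x_g (R : realType) (x y z : R) :
  partial_x (@g R) (torus_proj (x, y, z)) = cos (x + y) - cos (x + z).
Proof.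
apply: (@partial_xE _ _ (sin (x + y) - sin (x + z)) (- cos (y - z))) => t.
by rewrite gE !(addrAC x t) (sinD (x + y)) (sinD (x + z)); ring.
Qed.

Lemma partial_y_g (R : realType) (x y z : R) :
  partial_y (@g R) (torus_proj (x, y, z)) = cos (x + y) + sin (y - z).
Proof.
apply: (@partial_yE _ _ (sin (x + y) - cos (y - z)) (- sin (x + z))) => t.
by rewrite gE !addrA (addrAC y t) (sinD (x + y)) (cosD (y - z)); ring.
Qed.

Lemma partial_z_g (R : realType) (x y z : R) :
  partial_z (@g R) (torus_proj (x, y, z)) = - sin (y - z) - cos (x + z).
Proof.
apply: (@partial_zE _ _ (- cos (y - z) - sin (x + z)) (sin (x + y))) => t.
by rewrite gE opprD !addrA (cosB (y - z)) (sinD (x + z)); ring.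
Qed.

Lemma laplacian_g (R : realType) (p : torus R) :
  - laplacian (@g R) p = 2 * g p.
Proof.
have [x [y [z ->]]] := torus_projP _ p; rewrite /laplacian gE.
have -> : partial_x (partial_x (@g R)) (torus_proj (x, y, z)) =
    sin (x + z) - sin (x + y).
  apply: (@partial_xE _ _ (cos (x + y) - cos (x + z)) 0) => t.
  by rewrite partial_x_g !(addrAC x t) (cosD (x + y)) (cosD (x + z)); ring.
have -> : partial_y (partial_y (@g R)) (torus_proj (x, y, z)) =
    cos (y - z) - sin (x + y).
  apply: (@partial_yE _ _ (cos (x + y) + sin (y - z)) 0) => t.
  rewrite partial_y_g !addrA (addrAC y t) (cosD (x + y)) (sinD (y - z)); ring.
have -> : partial_z (partial_z (@g R)) (torus_proj (x, y, z)) =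
    cos (y - z) + sin (x + z).
  apply: (@partial_zE _ _ (- sin (y - z) - cos (x + z)) 0) => t.
  by rewrite partial_z_g opprD !addrA (sinB (y - z)) (cosD (x + z)); ring.
ring.
Qed.

(** * The length of an arc *)

Lemma cos_period (R : realType) (x : R) (n : int) :
  cos (x + n%:~R * (2 * pi)) = cos x.
Proof.
have nat_period (m : nat) (y : R) : cos (y + m%:R * (2 * pi)) = cos y.
  by rewrite !mulr_natl (periodicn (@cosD2pi R)).
case: (intP n) => [|m|m]; first by rewrite mul0r addr0.
  exact: nat_period.
by rewrite -(nat_period m.+1 (_ + _)) mulrNz mulNr subrK.
Qed.

Lemma lt_cos_norm (R : realType) (u al : R) :
  `|u| < al -> al <= pi -> cos al < cos u.
Proof.
move=> ual alpi; have u0 := normr_ge0 u.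
rewrite -(cos_norm u) ltr_cos //; rewrite in_itv /=; apply/andP; split; lra.
Qed.

Lemma measurable_arc (R : realType) (c phi : R) :
  measurable ([set x | c < cos (x + phi)] : set (measurableTypeR R)).
Proof.
rewrite -[X in measurable X]setTI.
rewrite [X in _ `&` X](_ : _ =
  (fun x => c < cos (x + phi)) @^-1` [set true]) //.
apply: (measurable_fun_ltr _ _ measurableT) => //.
apply: continuous_measurable_fun => x.
apply: continuous_comp; last exact: continuous_cos.
by apply: cvgD; [exact: cvg_id|exact: cvg_cst].
Qed.

(** The arc lifts to an interval of length [2 * al] whose left end s lies in the
    period; if this interval passes [2 * pi], its tail re-enters at 0. *)
Lemma arc_length_ge (R : realType) (phi al : R) : 0 <= al <= pi ->
  ((2 * al)%:E <= lebesgue_measure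
    (`[0%R, (2 * pi)%R[ `&` [set x : R | (cos al < cos (x + phi))%R]))%E.
Proof.
move=> /andP[al0 alpi]; have pi0 := pi_gt0 R.
pose n := Num.floor ((- phi - al) / (2 * pi)).
pose s := - phi - al - n%:~R * (2 * pi).
have [s0 s2pi] : 0 <= s /\ s < 2 * pi.
  have tpi : 0 < 2 * pi :> R by lra.
  have /andP[] := floor_itv ((- phi - al) / (2 * pi)).
  by rewrite -/n ler_pdivlMr // ltr_pdivrMr // intrD mulrDl /s; split; lra.
have arcP x : s < x < s + 2 * al -> cos al < cos (x + phi).
  move=> /andP[sx xs].
  have -> : x + phi = (x - s - al) + (- n)%:~R * (2 * pi).
    by rewrite /s mulrNz; ring.
  by rewrite cos_period; apply: lt_cos_norm => //; rewrite ltr_norml; lra.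
have arcP2 x : s < x + 2 * pi < s + 2 * al -> cos al < cos (x + phi).
  move=> /arcP; congr (_ < _).
  by rewrite addrAC -[X in _ + X](mul1r _) (cos_period _ _ 1).
have mA := measurableI _ _ (measurable_itv `[0, 2 * pi[)
  (measurable_arc R (cos al) phi).
have [le2pi|gt2pi] := leP (s + 2 * al) (2 * pi).
  have [->|al_gt0] := eqVneq al 0; first by rewrite mulr0.
  have -> : (2 * al)%:E = lebesgue_measure (`]s, s + 2 * al[%classic : set R).
    rewrite lebesgue_measure_itv /= lte_fin ifT; last by lra.
    by rewrite -EFinD; congr EFin; ring.
  apply: le_measure; rewrite ?inE //.
  move=> x /=; rewrite !in_itv /= => /andP[sx xs]; split; first by lra.
  by apply: arcP; rewrite sx.
pose e := s + 2 * al - 2 * pi.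
have -> : (2 * al)%:E =
    lebesgue_measure (`[0%R, e[%classic `|` `]s, 2 * pi[%classic : set R).
  rewrite measureU //=; last first.
    apply/seteqP; split=> // x /= []; rewrite !in_itv /= => /andP[_ xe].
    move=> /andP[sx _]; exfalso; rewrite /e in xe; lra.
  rewrite !lebesgue_measure_itv /= !lte_fin !ifT //; last by rewrite /e; lra.
  by rewrite -!EFinD /e; congr EFin; ring.
apply: le_measure; rewrite ?inE //.
  by apply: measurableU; exact: measurable_itv.
move=> x /=; rewrite !in_itv /= => -[] /andP[x0 xe]; split.
- by rewrite /e in xe; lra.
- by apply: arcP2; rewrite /e in xe; lra.
- by lra.
- by apply: arcP; rewrite x0 /=; lra.
Qed.

Lemma cos_pi3 (R : realType) : cos (pi / 3) = 1 / 2 :> R.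
Proof.
have pi0 := pi_gt0 R; set c := cos _.
have c_gt0 : 0 < c by apply: cos_gt0_pihalf; lra.
have : cos (pi / 3 *+ 2 + pi / 3) = -1 :> R.
  by rewrite -cospi; congr cos; field.
rewrite cosD cos_mulr2n sin_mulr2n -/c.
rewrite (_ : _ - _ = (c ^+ 2 *+ 2 - 1) * c - c * (sin (pi / 3) ^+ 2) *+ 2);
  last by ring.
rewrite sin2cos2 -/c => E.
(* The triple angle formula: [4 c^3 - 3 c = -1]. *)
have : (c + 1) * (2 * c - 1) ^+ 2 = 0.
  rewrite (_ : _ * _ = (c ^+ 2 *+ 2 - 1) * c - c * (1 - c ^+ 2) *+ 2 + 1);
    last by ring.
  by rewrite E; ring.
move=> /eqP; rewrite mulf_eq0 sqrf_eq0 => /orP[] /eqP; lra.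
Qed.

(** The exact value is [sqrt 3 / 2]; what matters is that the bound exceeds
    [sqrt 3 - 1]. *)
Lemma cos_pi6_gt (R : realType) : 4 / 5 < cos (pi / 6) :> R.
Proof.
have pi0 := pi_gt0 R.
have c_gt0 : 0 < cos (pi / 6) :> R by apply: cos_gt0_pihalf; lra.
have : cos (pi / 6 *+ 2) = 1 / 2 :> R.
  by rewrite -cos_pi3; congr cos; field.
by rewrite cos_mulr2n; nra.
Qed.

(** * The fibres of the negative set *)

(** S is the absolute value of [sin w], where [2 w = x + y + pi / 2]; its sign
    is absorbed by phi. *)
Lemma g_lift_amplitude (R : realType) (x y : R) : exists S phi,
  [/\ 0 <= S, cos (y + (x + pi / 2)) = 1 - 2 * S ^+ 2
    & forall z, g_lift (x, y, z) = 2 * S ^+ 2 - 1 - 2 * S * cos (z + phi)].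
Proof.
pose w := (x + y + pi / 2) / 2; pose m := (x - y + pi / 2) / 2.
have cosE : cos (y + (x + pi / 2)) = 1 - 2 * sin w ^+ 2.
  rewrite (_ : y + (x + pi / 2) = w *+ 2); last by rewrite /w; field.
  by rewrite cos_mulr2n cos2sin2; ring.
have gwE z : g_lift (x, y, z) = 2 * sin w ^+ 2 - 1 - 2 * sin w * sin (z + m).
  rewrite /g_lift.
  have -> : sin (x + y) = 2 * sin w ^+ 2 - 1.
    by rewrite -[LHS]opprK -cosDpihalf -addrA addrCA cosE; ring.
  have -> : cos (y - z) = cos (z + m - w).
    by rewrite -[in LHS]cosN; congr cos; rewrite /m /w; field.
  have -> : sin (x + z) = - cos (z + m + w).
    by rewrite -[LHS]opprK -cosDpihalf; congr (- cos _); rewrite /m /w; field.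
  by rewrite (cosB (z + m)) (cosD (z + m)); ring.
have [w0|w0] := leP 0 (sin w).
- exists (sin w), (m - pi / 2); split=> // z.
  by rewrite gwE addrA cosBpihalf.
- exists (- sin w), (m + pi / 2); rewrite sqrrN; split=> [||z] //; first by lra.
  by rewrite gwE addrA cosDpihalf; ring.
Qed.

Lemma measurable_g_lift (R : realType) :
  measurable_fun setT (@g_lift R : borel3 R -> measurableTypeR R).
Proof.
have mx : measurable_fun setT (fun v : borel3 R => v.1.1).
  exact: measurableT_comp measurable_fst measurable_fst.
have my : measurable_fun setT (fun v : borel3 R => v.1.2).
  exact: measurableT_comp measurable_snd measurable_fst.
have mz : measurable_fun setT (fun v : borel3 R => v.2).
  exact: measurable_snd.
have msin : measurable_fun setT (@sin R).
  by apply: continuous_measurable_fun; exact: continuous_sin.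
have mcos : measurable_fun setT (@cos R).
  by apply: continuous_measurable_fun; exact: continuous_cos.
rewrite (_ : @g_lift R = fun v : borel3 R =>
    sin (v.1.1 + v.1.2) - cos (v.1.2 - v.2) - sin (v.1.1 + v.2)).
  apply: measurable_funB; first apply: measurable_funB.
  - by apply: measurableT_comp msin _; exact: measurable_funD.
  - by apply: measurableT_comp mcos _; exact: measurable_funB.
  - by apply: measurableT_comp msin _; exact: measurable_funD.
by apply/funext => -[[x y] z].
Qed.

(** The set of the points of [R^3] above the points of the torus where g is
    negative. *)
Definition negative_set (R : realType) : set (borel3 R) :=
  [set v | g_lift v < 0].

Lemma measurable_negative_set (R : realType) : measurable (negative_set R).
Proof.
rewrite -[X in measurable X]setTI.
rewrite [X in _ `&` X](_ : _ = (fun v => g_lift v < 0) @^-1` [set true]) //.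
exact: (measurable_fun_ltr (measurable_g_lift R) _ measurableT).
Qed.

(** The pairs (x, y) such that [cos (x + y + pi / 2) > cos be]. *)
Definition band (R : realType) (be : R) :
    set (measurableTypeR R * measurableTypeR R) :=
  [set p | cos be < cos (p.2 + (p.1 + pi / 2))].
Arguments band {R}.

Lemma measurable_band (R : realType) (be : R) : measurable (band be).
Proof.
have mcos : measurable_fun setT (@cos R).
  by apply: continuous_measurable_fun; exact: continuous_cos.
rewrite -[X in measurable X]setTI.
rewrite [X in _ `&` X](_ : _ =
  (fun p : measurableTypeR R * measurableTypeR R =>
     cos be < cos (p.2 + (p.1 + pi / 2))) @^-1` [set true]) //.
apply: (measurable_fun_ltr _ _ measurableT) => //.
apply: measurableT_comp mcos _.
by apply: measurable_funD => //; exact: measurable_funD.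
Qed.

(** The bands for [pi / 2], [pi / 3] and [pi / 6] decrease, so the step function
    on the left takes the values [2 al] for [al = pi / 3] outside them and
    [al = pi / 2], [2 pi / 3], [pi] inside one, two or three of them. *)
Lemma negative_fibre_ge (R : realType) (x y : R) :
  ((2 / 3 * pi + pi / 3 * \1_(band (pi / 2)) (x, y)
    + pi / 3 * \1_(band (pi / 3)) (x, y)
    + 2 / 3 * pi * \1_(band (pi / 6)) (x, y))%:E
   <= lebesgue_measure
       (`[0%R, (2 * pi)%R[ `&` xsection (negative_set R) (x, y)))%E.
Proof.
have pi0 := pi_gt0 R.
have [S [phi [S0 SE gE]]] := g_lift_amplitude _ x y.
have indic01 (A : set (measurableTypeR R * measurableTypeR R)) :
    0 <= (\1_A (x, y) : R) <= 1.
  by rewrite indicE ler0n lern1 leq_b1.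
have p1 := indic01 (band (pi / 2)).
have p2 := indic01 (band (pi / 3)).
have p3 := indic01 (band (pi / 6)).
have cos_2pi3 : cos (2 / 3 * pi) = - (1 / 2) :> R.
  rewrite (_ : 2 / 3 * pi = - (pi / 3) + pi); last by field.
  by rewrite cosDpi cosN cos_pi3.
(* It suffices to find a half-width al such that g is negative wherever
   [cos (z + phi) > cos al]. *)
have from_arc (al c : R) : 0 <= al <= pi -> c <= 2 * al ->
    (forall u, cos al < u -> u <= 1 -> 2 * S ^+ 2 - 1 - 2 * S * u < 0) ->
    (c%:E <= lebesgue_measure
       (`[0%R, (2 * pi)%R[ `&` xsection (negative_set R) (x, y)))%E.
  move=> alP cal neg.
  apply: (@le_trans _ _ (2 * al)%:E); first by rewrite lee_fin.
  apply: (le_trans (arc_length_ge _ phi _ alP)).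
  apply: le_measure; rewrite ?inE //.
  - exact: measurableI (measurable_itv _) (measurable_arc _ _ _).
  - apply: measurableI; first exact: measurable_itv.
    by apply: measurable_xsection; exact: measurable_negative_set.
  - move=> z /= [? za]; split=> //.
    apply: mem_set; rewrite /negative_set /=.
    by move: (gE z) => /= ->; apply: neg => //; exact: cos_le1.
have [y3|y3] := boolP ((x, y) \in band (pi / 6)).
  apply: (from_arc pi); [by rewrite lexx andbT; lra | by nra |].
  move=> u; rewrite cospi; move: y3; rewrite inE /band /= SE.
  have := cos_pi6_gt R; move: (cos _) => c; nra.
have y3E : \1_(band (pi / 6)) (x, y) = 0 :> R by rewrite indicE (negbTE y3).
rewrite y3E.
have [y2|y2] := boolP ((x, y) \in band (pi / 3)).
  apply: (from_arc (2 / 3 * pi)); [by apply/andP; split; lra | by nra |].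
  by move=> u; rewrite cos_2pi3; move: y2; rewrite inE /band /= SE cos_pi3; nra.
have y2E : \1_(band (pi / 3)) (x, y) = 0 :> R by rewrite indicE (negbTE y2).
rewrite y2E.
have [y1|y1] := boolP ((x, y) \in band (pi / 2)).
  apply: (from_arc (pi / 2)); [by apply/andP; split; lra | by nra |].
  move=> u; rewrite cos_pihalf; move: y1.
  by rewrite inE /band /= SE cos_pihalf; nra.
have y1E : \1_(band (pi / 2)) (x, y) = 0 :> R by rewrite indicE (negbTE y1).
rewrite y1E.
apply: (from_arc (pi / 3)); [by apply/andP; split; lra | by nra |].
move=> u; rewrite cos_pi3; have := cos_geN1 (y + (x + pi / 2)); rewrite SE; nra.
Qed.

(** * Integration over the fibres *)

(** One half of Tonelli's theorem: a lower bound for the measures of the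
    sections over D integrates to a lower bound for the measure of A. *)
Lemma product_measure_section_ge d1 d2 (T1 : measurableType d1)
    (T2 : measurableType d2) (R : realType) (m1 : {measure set T1 -> \bar R})
    (m2 : {sigma_finite_measure set T2 -> \bar R})
    (A : set (T1 * T2)) (D : set T1) (f : T1 -> \bar R) :
  measurable A -> measurable D -> measurable_fun D f ->
  (forall x, D x -> 0 <= f x)%E ->
  (forall x, D x -> f x <= m2 (xsection A x))%E ->
  (\int[m1]_(x in D) f x <= (m1 \x m2) A)%E.
Proof.
move=> mA mD mf f0 fA.
have mS := measurable_fun_xsection m2 mA.
apply: (@le_trans _ _ (\int[m1]_(x in D) (m2 \o xsection A) x)%E).
  by apply: ge0_le_integral => //; exact: measurable_funS mS.
by apply: ge0_subset_integral => //; exact: mS.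
Qed.

Lemma lebesgue_measure_period (R : realType) :
  lebesgue_measure (`[0%R, (2 * pi)%R[%classic : set R) = (2 * pi)%:E.
Proof.
have pi0 := pi_gt0 R.
rewrite lebesgue_measure_itv /= lte_fin ifT; last by lra.
by rewrite oppr0 adde0.
Qed.

(** The square of the pairs (x, y) with x and y in one period. *)
Definition square (R : realType) :
    set (measurableTypeR R * measurableTypeR R) :=
  `[0%R, (2 * pi)%R[ `*` `[0%R, (2 * pi)%R[.

Lemma measurable_square (R : realType) : measurable (square R).
Proof. by apply: measurableX; exact: measurable_itv. Qed.

Lemma square_area (R : realType) :
  (@lebesgue_measure R \x @lebesgue_measure R)%E (square R) =
  (4 * pi ^+ 2)%:E.
Proof.
rewrite product_measure1E //= !lebesgue_measure_period -EFinM.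
by congr EFin; ring.
Qed.

Lemma band_area_ge (R : realType) (be : R) : 0 <= be <= pi ->
  ((4 * pi * be)%:E <=
   (@lebesgue_measure R \x @lebesgue_measure R) (square R `&` band be))%E.
Proof.
move=> bepi; have /andP[be0 _] := bepi.
pose D : set (measurableTypeR R) := `[0%R, (2 * pi)%R[%classic.
have mD : measurable D by exact: measurable_itv.
apply: (@le_trans _ _ (\int[lebesgue_measure]_(x in D) (2 * be)%:E)%E).
  rewrite integral_cst // [X in (_ * X)%E]lebesgue_measure_period -EFinM.
  by rewrite lee_fin le_eqVlt; apply/orP; left; apply/eqP; ring.
apply: product_measure_section_ge => //.
- by apply: measurableI; [exact: measurable_square|exact: measurable_band].
- by move=> x _; rewrite lee_fin mulr_ge0.
- move=> x Dx; rewrite xsectionI in_xsectionX ?inE //.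
  rewrite (_ : xsection (band be) x =
      [set y | cos be < cos (y + (x + pi / 2))]).
    exact: arc_length_ge.
  by apply/seteqP; split=> y; rewrite /xsection /= inE.
Qed.

Lemma integral_band_ge (R : realType) (c be : R) : 0 <= c -> 0 <= be <= pi ->
  ((c * (4 * pi * be))%:E <=
   \int[(@lebesgue_measure R \x @lebesgue_measure R)%E]_(p in square R)
     (c * \1_(band be) p)%:E)%E.
Proof.
move=> c0 bepi; have mB := measurable_band R be.
have c_lt0 : c < 0 -> band be = set0 by rewrite ltNge c0.
rewrite (integralZl_indic (measurable_square R) (fun=> band be) c) //.
rewrite integral_indic //; last exact: measurable_square.
by rewrite setIC EFinM lee_wpmul2l ?lee_fin //; exact: band_area_ge.
Qed.

Lemma negative_volume_ge (R : realType) :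
  ((38 / 9 * pi ^+ 3)%:E <= lebesgue_measure3 (negative_set R `&` @cube R))%E.
Proof.
have pi0 := pi_gt0 R.
have mQ := measurable_square R.
pose f (p : measurableTypeR R * measurableTypeR R) : \bar R :=
  ((2 / 3 * pi)%:E + (pi / 3 * \1_(band (pi / 2)) p)%:E
    + (pi / 3 * \1_(band (pi / 3)) p)%:E
    + (2 / 3 * pi * \1_(band (pi / 6)) p)%:E)%E.
have c1 : 0 <= 2 / 3 * pi :> R by lra.
have c2 : 0 <= pi / 3 :> R by lra.
have i0 (c be : R) p : 0 <= c -> 0 <= c * \1_(band be) p.
  by move=> c0; apply: mulr_ge0 => //; rewrite indicE ler0n.
have mi (c be : R) :
    measurable_fun (square R) (fun p => (c * \1_(band be) p)%:E).
  apply/measurable_EFinP; apply: measurable_funM => //.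
  by apply: measurable_indic; exact: measurable_band.
apply: (@le_trans _ _
  (\int[(@lebesgue_measure R \x @lebesgue_measure R)%E]_(p in square R) f p)%E).
  rewrite /f !ge0_integralD //=; try by [
    move=> p _; rewrite ?adde_ge0 ?lee_fin ?i0 | do ?apply: emeasurable_funD].
  rewrite integral_cst // [X in (_ * X)%E]square_area -EFinM.
  have e1 := integral_band_ge R _ (pi / 2) c2.
  have e2 := integral_band_ge R _ (pi / 3) c2.
  have e3 := integral_band_ge R _ (pi / 6) c1.
  rewrite (_ : 38 / 9 * pi ^+ 3 = 2 / 3 * pi * (4 * pi ^+ 2)
    + pi / 3 * (4 * pi * (pi / 2)) + pi / 3 * (4 * pi * (pi / 3))
    + 2 / 3 * pi * (4 * pi * (pi / 6))); last by field.
  rewrite !EFinD !leeD //; [apply: e1|apply: e2|apply: e3];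
    by apply/andP; split; lra.
apply: product_measure_section_ge => //.
- apply: measurableI; first exact: measurable_negative_set.
  exact: measurable_cube.
- by do ?apply: emeasurable_funD.
- by move=> p _; rewrite !adde_ge0 // lee_fin ?i0.
- move=> [x y] Qxy; rewrite setIC xsectionI in_xsectionX ?inE //.
  by rewrite /f -!EFinD; exact: negative_fibre_ge.
Qed.

Lemma volume_torus (R : realType) : vol [set: torus R] = (8 * pi ^+ 3)%:E.
Proof.
rewrite /vol /pushforward /mrestr preimage_setT setTI /lebesgue_measure3 /cube.
rewrite product_measure1E //=; last exact: measurableX.
rewrite product_measure1E //= !lebesgue_measure_period.
by rewrite -!EFinM; congr EFin; ring.
Qed.

Theorem theorem2p6 (R : realType) :
  (forall p : torus R, - laplacian (@g R) p = 2 * g p) /\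
  ((52 / 100)%:E * vol [set: torus R] <= vol [set p : torus R | (g p < 0)%R])%E.
Proof.
split; first exact: laplacian_g.
have pi3 : 0 < (pi : R) ^+ 3 by rewrite exprn_gt0 // pi_gt0.
rewrite volume_torus -EFinM.
apply: (@le_trans _ _ (38 / 9 * pi ^+ 3)%:E); first by rewrite lee_fin; lra.
rewrite /vol /pushforward /mrestr.
rewrite (_ : _ @^-1` _ = negative_set R); first exact: negative_volume_ge.
by apply/seteqP; split=> -[[x y] z]; rewrite /negative_set /= gE.
Qed.
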